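(* There exists $n_0 \in \mathbb{N}$ such that for all integers $n > n_0$ and all integers $q \geq 0$, $$L(n,q) \;\geq\; \frac{2^n(n-2)}{3\log_2 (n+q)} - \frac{n}{3}.$$
   Context: For $N\ge 1$, $j\in\{1,\dots,N\}$ and $I \subseteq \{1,\dots,N\}\setminus\{j\}$, the gate $TOF(I;j)$ on $N$ inputs defines the transformation $\mathbb{Z}_2^N \to \mathbb{Z}_2^N$ that replaces $x_j$ by $x_j \oplus \bigwedge_{i\in I} x_i$ and leaves all other coordinates unchanged; for $I=\emptyset$ it is the NOT gate $x_j \mapsto x_j\oplus 1$. Let $\Omega_N^2$ be the set of all gates $TOF(I;j)$ on $N$ inputs with $|I|\le 2$ (NOT, CNOT and 2-CNOT gates). A reversible circuit $\mathfrak{S}$ with $N$ inputs is a finite sequence (composition) of $l\ge 0$ gates from $\Omega_N^2$, applied one after another; it defines a transformation $g:\mathbb{Z}_2^N\to\mathbb{Z}_2^N$. Its gate complexity is $L(\mathfrak{S}) = l$. A reversible circuit with $n+q$ inputs ($q\ge 0$) defining $g:\mathbb{Z}_2^{n+q}\to\mathbb{Z}_2^{n+q}$ implements $f:\mathbb{Z}_2^n\to\mathbb{Z}_2^n$ with $q$ additional inputs if there is a permutation $\pi$ of $\{1,\dots,n+q\}$ such that for every $x\in\mathbb{Z}_2^n$, writing $g(x_1,\dots,x_n,0,\dots,0) = (y_1,\dots,y_{n+q})$, one has $f(x) = (y_{\pi(1)},\dots,y_{\pi(n)})$. $F(n,q)$ is the set of all transformations $\mathbb{Z}_2^n\to\mathbb{Z}_2^n$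 that can be implemented by reversible circuits with $n+q$ inputs (gates from $\Omega_{n+q}^2$). For $f\in F(n,q)$, $L(f,q)$ is the minimum of $L(\mathfrak{S})$ over all circuits $\mathfrak{S}$ of gates from $\Omega_{n+q}^2$ implementing $f$ with $q$ additional inputs, and $L(n,q) = \max_{f\in F(n,q)} L(f,q)$. *)

(* Defs.v *)
(* MathComp / MathComp-Analysis *)
From HB Require Import structures.
From mathcomp Require Import all_boot all_order all_algebra all_fingroup.
From mathcomp Require Import all_classical all_reals all_analysis.
Set Implicit Arguments.
Unset Strict Implicit.
Unset Printing Implicit Defensive.
Import Order.TTheory GRing.Theory Num.Theory.

Definition bvec (N : nat) := {ffun 'I_N -> bool}.

(* The pair (I, j) stands for TOF(I;j). *)
Definition gate (N : nat) :=
  {g : {set 'I_N} * 'I_N | (g.2 \notin g.1) && (#|g.1| <= 2)}.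

Definition gate_controls (N : nat) (g : gate N) : {set 'I_N} := (val g).1.
Definition gate_target (N : nat) (g : gate N) : 'I_N := (val g).2.

Definition gate_fun (N : nat) (g : gate N) (x : bvec N) : bvec N :=
  [ffun k => if k == gate_target g
             then x k (+) [forall (i | i \in gate_controls g), x i]
             else x k].

(* The head of the sequence is the gate applied first. *)
Definition circuit (N : nat) := seq (gate N).

Definition circuit_fun (N : nat) (S : circuit N) (x : bvec N) : bvec N :=
  foldl (fun y g => gate_fun g y) x S.

Definition complexity (N : nat) (S : circuit N) : nat := size S.

Definition pad0 (n q : nat) (x : bvec n) : bvec (n + q) :=
  [ffun k : 'I_(n + q) => match fintype.split k with inl i => x i | inr _ => false end].

Definition implements (n q : nat) (S : circuit (n + q))
    (f : {ffun bvec n -> bvec n}) : Prop :=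
  exists p : {perm 'I_(n + q)}, forall (x : bvec n) (i : 'I_n),
    f x i = circuit_fun S (pad0 q x) (p (lshift q i)).

Definition implementable_set (n q : nat) : {set {ffun bvec n -> bvec n}} :=
  [set f | `[< exists S : circuit (n + q), implements S f >]].

Definition has_complexity (n q : nat) (f : {ffun bvec n -> bvec n}) : pred nat :=
  fun l => `[< exists S : circuit (n + q), implements S f /\ complexity S = l >].

(* L(f, q); the value 0 outside F(n, q) is a dummy that is never used below. *)
Definition min_complexity (n q : nat) (f : {ffun bvec n -> bvec n}) : nat :=
  match pselect (exists l, has_complexity q f l) with
  | left e => ex_minn e
  | right _ => 0
  end.

(* L(n, q): F(n, q) is nonempty (the empty circuit implements the identity),
   so the value of the maximum over the empty set plays no role. *)
Definition max_complexity (n q : nat) : nat :=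
  \max_(f in implementable_set n q) min_complexity q f.

Definition log2 (R : realType) (x : R) : R := (ln x / ln 2)%R.

(* Main.v *)
(** Counting. Put [N = n + q]. A gate with at most two controls is determined by
a triple of wires, and such a triple can also code "no gate", so at most
[N ^ (3 s + n)] transformations are implemented by circuits of at most [s]
gates (the factor [N ^ n] accounts for the output permutation). Conversely, for
[n >= 4] the gates already generate, without additional inputs, every even
permutation of the [M = 2 ^ n] binary vectors, and
[M! / 2 >= (M / 4) ^ M = 2 ^ (2 ^ n (n - 2))]. Taking logarithms gives the
bound.

The alternating group is reached as follows: commutators of gates yield gates
with up to [n - 2] controls; with [n - 2] controls such a gate is the product of
two transpositions along parallel edges of a square face of the cube. Two such
products whose faces share exactly one vertex have a 3-cycle as commutator, so
the product of the transpositions of any two edges lies in the group, hence so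
does the product of any two transpositions. *)

Require Import Defs.
From HB Require Import structures.
From mathcomp Require Import all_boot all_order all_algebra all_fingroup.
From mathcomp Require Import all_classical all_reals all_analysis.
From mathcomp Require Import fintype finset alt.
Import Order.TTheory GRing.Theory Num.Theory.
Set Implicit Arguments.
Unset Strict Implicit.
Unset Printing Implicit Defensive.
Local Open Scope ring_scope.

(** * Products of two transpositions in a permutation group *)

Section TranspositionPairs.
Local Open Scope group_scope.
Variables (T : finType) (G : {group {perm T}}).

Lemma tperm_pair_sym (x y z w : T) :
  tperm x y * tperm z w \in G -> tperm z w * tperm x y \in G.
Proof. by move=> h; rewrite -groupV invMg !tpermV. Qed.

(** The middle transposition cancels. Having a product in [G] is thus an equivalence relation on
    transpositions, and the aim is a single class. *)
Lemma tperm_pair_trans (z w x y u v : T) :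
  tperm x y * tperm z w \in G -> tperm z w * tperm u v \in G ->
  tperm x y * tperm u v \in G.
Proof.
by move=> h1 h2; have := groupM h1 h2;
  rewrite mulgA -(mulgA (tperm x y)) tperm2 mulg1.
Qed.

Lemma tperm_conj_outer (x y z : T) : x != y -> x != z ->
  tperm y z * tperm x y * tperm y z = tperm x z.
Proof.
move=> xy xz; rewrite -{1}[tperm y z]tpermV -mulgA -/(conjg _ _) tpermJ.
by rewrite tpermL tpermD // eq_sym.
Qed.

(** The conclusion's product is the square of the hypothesis' one. *)
Lemma tperm_pair_step (x y z : T) : x != y -> x != z ->
  tperm y z * tperm x y \in G -> tperm x z * tperm x y \in G.
Proof. by move=> xy xz h; rewrite -(tperm_conj_outer xy xz) -mulgA groupM. Qed.

(** An even permutation is a product of an even number of transpositions, which are removed two at a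
    time. *)
Lemma tperm_pairs_Alt :
  (forall x y z w : T, x != y -> z != w -> tperm x y * tperm z w \in G) ->
  'Alt_T \subset G.
Proof.
move=> pairs; apply/subsetP => s.
rewrite Alt_even.
have [ts -> dts] := prod_tpermP s.
rewrite odd_perm_prod //.
have [m] := ubnP (size ts); elim: m ts dts => // m IHm.
case=> [|t [|u ts]] //=; first by rewrite big_nil.
rewrite !big_cons => /and3P[t1 u1 dts] sz ev.
rewrite mulgA groupM ?pairs // IHm //; first by rewrite ltnS in sz; exact: ltnW.
by rewrite negbK in ev.
Qed.

Lemma tperm_commute (x y z w : T) :
  x != z -> x != w -> y != z -> y != w -> commute (tperm x y) (tperm z w).
Proof.
by move=> *; rewrite /commute conjgC tpermJ ![tperm z w _]tpermD // eq_sym.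
Qed.

End TranspositionPairs.

(** * The cube of binary vectors and controlled flips on it *)

Section Cube.
Variable n : nat.
Implicit Types (x y : bvec n) (i j k l : 'I_n) (I : {set 'I_n}).

Definition flip k x : bvec n := [ffun i => x i (+) (i == k)].

Lemma flipE k x i : flip k x i = x i (+) (i == k).
Proof. by rewrite ffunE. Qed.

Lemma flipK k : involutive (flip k).
Proof. by move=> x; apply/ffunP=> i; rewrite !flipE -addbA addbb addbF. Qed.

Lemma flipC j k x : flip j (flip k x) = flip k (flip j x).
Proof. by apply/ffunP=> i; rewrite !flipE addbAC. Qed.

Lemma flip_neq k x : x != flip k x.
Proof.
by apply/eqP=> /ffunP/(_ k); rewrite flipE eqxx addbT; case: (x k).
Qed.

(** Induction on the Hamming distance to [x0]: flipping a coordinate where [x] and [x0] differ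
    lowers it. *)
Lemma flip_ind (P : bvec n -> Prop) x0 :
  P x0 -> (forall k x, P x -> P (flip k x)) -> forall x, P x.
Proof.
move=> P0 Pf x.
have [m] := ubnP #|[set i | x i != x0 i]|; elim: m x => // m IHm x lt_m.
have [/eqP d0|[k]] := set_0Vmem [set i | x i != x0 i].
  suff -> : x = x0 by [].
  apply/ffunP=> i; apply/eqP; apply: contraTT d0 => xi.
  by apply/set0Pn; exists i; rewrite inE.
rewrite inE => xk; rewrite -(flipK k x); apply/Pf/IHm.
rewrite -ltnS; apply: leq_trans _ lt_m; rewrite !ltnS; apply: proper_card.
apply/properP; split.
  apply/subsetP=> i; rewrite !inE flipE.
  by have [->|] := eqVneq i k; rewrite ?addbF.
exists k; rewrite !inE // flipE eqxx addbT.
by move: xk; case: (x k); case: (x0 k).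
Qed.

Definition on_face I y x := [forall (i | i \in I), x i == y i].

Lemma on_face_flip I y k x : on_face I y (flip k x) = on_face I (flip k y) x.
Proof.
apply: eq_forallb => i; rewrite !flipE.
by case: (i == k); case: (x i); case: (y i).
Qed.

Lemma on_face_flip_notin I y k x : k \notin I ->
  on_face I y (flip k x) = on_face I y x.
Proof.
move=> kI; apply: eq_forallb => i; rewrite flipE.
by have [->|] := eqVneq i k; rewrite ?addbF // (negbTE kI).
Qed.

Lemma on_face_setU1 I y k x :
  on_face (k |: I) y x = (x k == y k) && on_face I y x.
Proof.
apply/forall_inP/andP=> [h|[hk /forall_inP h] i].
  split; first by apply: h; rewrite setU11.
  by apply/forall_inP=> i iI; apply: h; rewrite setU1r.
by case/setU1P=> [->|] //; exact: h.
Qed.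

Lemma on_face0 y x : on_face set0 y x.
Proof. by apply/forall_inP=> i; rewrite inE. Qed.

(* TOF(I;l) with the control pattern [y] in place of all ones; [l] is removed
   from [I] only to obtain a permutation for every [I]. *)
Definition mcx_fun I l y x := if on_face (I :\ l) y x then flip l x else x.

Lemma mcx_funK I l y : involutive (mcx_fun I l y).
Proof.
move=> x; rewrite /mcx_fun; case h: (on_face (I :\ l) y x); last by rewrite h.
by rewrite on_face_flip_notin ?setD11 // h flipK.
Qed.

Definition mcx I l y : {perm bvec n} := perm (inv_inj (mcx_funK I l y)).

Lemma mcxE I l y x : l \notin I ->
  mcx I l y x = if on_face I y x then flip l x else x.
Proof.
by move=> lI; rewrite permE /mcx_fun (setDidPl _) // disjoint_sym disjoints1.
Qed.

(** Conjugation by NOT on wire [k] toggles the control pattern at [k]. *)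
Lemma mcx_flip I l y k : l \notin I ->
  (mcx set0 k y * mcx I l y * mcx set0 k y)%g = mcx I l (flip k y).
Proof.
move=> lI; apply/permP=> x; rewrite !permM !mcxE ?in_set0 // !on_face0.
by rewrite on_face_flip; case: ifP; rewrite ?(flipC l) flipK.
Qed.

(** The factors are involutions, so this is a commutator. Wire [j] is toggled on the face of [I] and
    then restored; if [k] matches, the two flips of [l] cancel unless [j] was toggled in between. *)
Lemma mcx_comm I y j k l : l \notin k |: I -> j \notin k |: I -> j != l ->
  (mcx I j y * mcx [set k; j] l y * mcx I j y * mcx [set k; j] l y)%g
  = mcx (k |: I) l y.
Proof.
rewrite !in_setU1 !negb_or => /andP[lk lI] /andP[jk jI] jl.
apply/permP=> x; rewrite !permM.
have lkj : l \notin [set k; j] by rewrite !inE negb_or lk eq_sym.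
have face2 z : on_face [set k; j] y z = (z k == y k) && (z j == y j).
  by rewrite on_face_setU1 -[[set j]]setU0 on_face_setU1 on_face0 andbT.
rewrite [RHS]mcxE ?in_setU1 ?negb_or ?lk // on_face_setU1.
have [kj kl lj] : [/\ (k == j) = false, (k == l) = false & (l == j) = false].
  by split; rewrite // eq_sym; apply/negbTE.
(* The orbit of [x] stays among four states: [u] records a toggle of [j], [v] one of [l]. *)
pose st u v : bvec n := [ffun i => x i (+) (u && (i == j)) (+) (v && (i == l))].
have flipj u v : flip j (st u v) = st (~~ u) v.
  apply/ffunP=> i; rewrite !ffunE.
  by case: (x i) (i == j) (i == l) u v => [] [] [] [] [].
have flipl u v : flip l (st u v) = st u (~~ v).
  apply/ffunP=> i; rewrite !ffunE.
  by case: (x i) (i == j) (i == l) u v => [] [] [] [] [].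
have st0 : x = st false false by apply/ffunP=> i; rewrite ffunE !addbF.
have onI u v : on_face I y (st u v) = on_face I y x.
  apply: eq_forallb => i; rewrite ffunE.
  have [ij|_] := eqVneq i j; first by rewrite ij (negbTE jI).
  have [il|_] := eqVneq i l; first by rewrite il (negbTE lI).
  by rewrite !andbF !addbF.
have mcxj u v : mcx I j y (st u v) = st (u (+) on_face I y x) v.
  by rewrite mcxE // onI; case: ifP => _; rewrite ?flipj ?addbT ?addbF.
have mcxl u v : mcx [set k; j] l y (st u v)
    = st u (v (+) ((x k == y k) && (x j (+) u == y j))).
  rewrite mcxE // face2 !ffunE kj kl eqxx [j == l]eq_sym lj !andbF andbT !addbF.
  by case: ifP => _; rewrite ?flipl ?addbT ?addbF.
rewrite st0 !(mcxj, mcxl) flipl -!st0.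
by case: (on_face I y x); case: (x k == y k); case: (x j); case: (y j);
  rewrite /= -?st0.
Qed.

Lemma neq_at i x y : x i != y i -> x != y.
Proof. by apply: contra_neq => ->. Qed.

Lemma mcx_tperm i l y : i != l ->
  mcx (~: [set i; l]) l y
  = (tperm y (flip l y) * tperm (flip i y) (flip l (flip i y)))%g.
Proof.
move=> il; have li : (l == i) = false by rewrite eq_sym (negbTE il).
have lI : l \notin ~: [set i; l] by rewrite !inE eqxx orbT.
have ne1 : flip i y != y by rewrite eq_sym flip_neq.
have ne2 : flip l (flip i y) != y.
  by apply/(@neq_at l); rewrite !flipE eqxx li addbF addbT; case: (y l).
have ne3 : flip i y != flip l y.
  by apply/(@neq_at l); rewrite !flipE eqxx li addbF addbT; case: (y l).
have ne4 : flip l (flip i y) != flip l y by rewrite (inj_eq (inv_inj (flipK l))).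
(* Only [i] and [l] are free, so the face is a square; a vertex is named by its agreement with [y]
   at these two wires. *)
have faceE x : on_face (~: [set i; l]) y x =
    [|| x == y, x == flip l y, x == flip i y | x == flip l (flip i y)].
  apply/forall_inP/idP=> [xy|].
    have xE m : x m = y m (+) (x m != y m) by case: (x m); case: (y m).
    have eqx (z : bvec n) : z i = x i -> z l = x l ->
        (forall m, m != i -> m != l -> z m = y m) -> x == z.
      move=> ei el eo; apply/eqP/ffunP=> m.
      have [->|mi] := eqVneq m i; first by rewrite ei.
      have [->|ml] := eqVneq m l; first by rewrite el.
      by rewrite eo //; apply/eqP/xy; rewrite !inE negb_or mi.
    have [] := (xE i, xE l).
    case hi: (x i == y i); case hl: (x l == y l) => xi xl; apply/or4P.
    - constructor 1; apply: eqx => //; [by rewrite xi addbF|by rewrite xl addbF].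
    - constructor 2; apply: eqx => [||m /negbTE mi /negbTE ml];
        by rewrite !flipE ?xi ?xl ?eqxx ?(negbTE il) ?li ?mi ?ml ?addbF.
    - constructor 3; apply: eqx => [||m /negbTE mi /negbTE ml];
        by rewrite !flipE ?xi ?xl ?eqxx ?(negbTE il) ?li ?mi ?ml ?addbF.
    - constructor 4; apply: eqx => [||m /negbTE mi /negbTE ml];
        by rewrite !flipE ?xi ?xl ?eqxx ?(negbTE il) ?li ?mi ?ml ?addbF.
  move=> h m; rewrite !inE negb_or => /andP[/negbTE mi /negbTE ml].
  by case/or4P: h => /eqP ->; rewrite ?flipE ?mi ?ml ?addbF.
apply/permP=> x; rewrite permM mcxE // faceE.
have [->|xy] := eqVneq x y; first by rewrite tpermL tpermD // eq_sym.
have [->|xly] := eqVneq x (flip l y).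
  by rewrite tpermR tpermD // flipK.
rewrite (tpermD (x := y)) 1?eq_sym //.
have [->|xiy] := eqVneq x (flip i y); first by rewrite tpermL.
have [->|xliy] := eqVneq x (flip l (flip i y)); first by rewrite tpermR flipK.
by rewrite tpermD // eq_sym.
Qed.

Lemma ex_notin (A : {set 'I_n}) : (#|A| < n)%N -> exists k, k \notin A.
Proof.
move=> ltA; have /card_gt0P[k kA] : (0 < #|~: A|)%N.
  by rewrite cardsCs setCK card_ord subn_gt0.
by exists k; rewrite inE in kA.
Qed.

(** * From gates with two controls to the alternating group *)

Variable G : {group {perm bvec n}}.
Hypothesis mcx_in2 : forall I l y, l \notin I -> (#|I| <= 2)%N -> mcx I l y \in G.

Lemma mcx_in I l y : l \notin I -> (#|I|.+2 <= n)%N -> mcx I l y \in G.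
Proof.
have [m] := ubnP #|I|; elim: m I l y => // m IHm I l y ltm lI leI.
have [le2|gt2] := leqP #|I| 2; first exact: mcx_in2.
have /card_gt0P[k kI] : (0 < #|I|)%N by apply: leq_trans gt2.
(* The commutator needs a spare wire besides [I] and [l]; this is where the limit of [n - 2]
   controls arises. *)
have [j] : exists j, j \notin l |: I by apply: ex_notin; rewrite cardsU1 lI.
rewrite in_setU1 negb_or => /andP[jl jI].
have kl : k != l by apply: contraNneq lI => <-.
have kj : k != j by apply: contraNneq jI => <-.
have card_I : #|I| = #|I :\ k|.+1 by rewrite (cardsD1 k I) kI.
rewrite -(setD1K kI) -(@mcx_comm _ y j) ?setD1K //.
have IHj : mcx (I :\ k) j y \in G.
  apply: IHm; rewrite ?inE ?(negbTE jI) ?andbF //; first by rewrite -ltnS -card_I.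
  by apply: leq_trans leI; rewrite card_I.
have kjl : mcx [set k; j] l y \in G.
  apply: mcx_in2; last by rewrite cards2; case: (_ != _).
  by rewrite !inE negb_or eq_sym kl eq_sym.
by rewrite !groupM.
Qed.

Hypothesis n_ge4 : (4 <= n)%N.

Definition edge l x := tperm x (flip l x).

Lemma edge_parallel i l x : i != l -> (edge l x * edge l (flip i x))%g \in G.
Proof.
move=> il; rewrite -mcx_tperm // mcx_in //; first by rewrite !inE eqxx orbT.
rewrite cardsCs setCK card_ord cards2 il.
by rewrite -addn2 subnK // (leq_trans _ n_ge4).
Qed.

Lemma edge_cross j l x : (edge l x * edge j x)%g \in G.
Proof.
have [->|lj] := eqVneq l j; first by rewrite tperm2.
have [i] : exists i, i \notin [set l; j].
  by apply: ex_notin; rewrite cards2 lj; apply: leq_trans n_ge4.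
rewrite !inE negb_or => /andP[il ij].
have [k] : exists k, k \notin i |: [set l; j].
  apply: ex_notin; rewrite cardsU1 cards2 lj !inE negb_or il ij.
  exact: leq_trans n_ge4.
rewrite !inE !negb_or => /and3P[ki kl kj].
(* The squares at [x] in directions [l, i] and [j, k] meet only in [x]; four distinct wires require
   [4 <= n]. *)
pose a := (edge l x * edge l (flip i x))%g.
pose b := (edge j x * edge j (flip k x))%g.
have aG : a \in G by exact: edge_parallel.
have bG : b \in G by exact: edge_parallel.
have ax : a x = flip l x.
  rewrite permM tpermL tpermD //.
    apply/(@neq_at l); rewrite !flipE eqxx [l == i]eq_sym (negbTE il) addbF.
    by case: (x l).
  apply/(@neq_at i); rewrite !flipE eqxx (negbTE il) !addbF.
  by case: (x i).
have afix (z : bvec n) : z i = x i -> z != x -> z != flip l x -> a z = z.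
  move=> zi zx zlx; rewrite permM (tpermD (x := x)) 1?eq_sym // tpermD //.
    by apply/(@neq_at i); rewrite !flipE eqxx zi addbT; case: (x i).
  by apply/(@neq_at i); rewrite !flipE eqxx (negbTE il) zi addbF addbT; case: (x i).
have ajx : a (flip j x) = flip j x.
  apply: afix; first by rewrite flipE (negbTE ij) addbF.
    by rewrite eq_sym flip_neq.
  by apply/(@neq_at l); rewrite !flipE eqxx (negbTE lj) addbF addbT; case: (x l).
have akx : a (flip k x) = flip k x.
  apply: afix; first by rewrite flipE [i == k]eq_sym (negbTE ki) addbF.
    by rewrite eq_sym flip_neq.
  by apply/(@neq_at k); rewrite !flipE eqxx (negbTE kl) addbF addbT; case: (x k).
have ajkx : a (flip j (flip k x)) = flip j (flip k x).
  apply: afix; first by rewrite !flipE [i == k]eq_sym (negbTE ki) (negbTE ij) !addbF.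
    by apply/(@neq_at k); rewrite !flipE eqxx (negbTE kj) addbF addbT; case: (x k).
  by apply/(@neq_at k); rewrite !flipE eqxx (negbTE kl) (negbTE kj) !addbF addbT;
    case: (x k).
have com : commute (edge j (flip k x)) (edge j x).
  by apply: tperm_commute; apply/(@neq_at k);
    rewrite !flipE eqxx ?(negbTE kj) ?addbF ?addbT; case: (x k).
(* [a] sends [x] to [flip l x] and fixes the other vertices of the square of [b]. So [b ^ a] is [b]
   with [x] replaced, the common edge cancels, and a 3-cycle remains when [l] and [j] differ. *)
have : (b ^ a * b)%g \in G by rewrite groupM ?groupJ.
rewrite conjMg !tpermJ ax ajx akx ajkx -mulgA (mulgA _ (edge j x)) com.
rewrite -mulgA tperm2 mulg1 tpermC => h.
by apply: tperm_pair_step h; exact: flip_neq.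
Qed.

(** Change the direction at [x], then walk to [y]: a step across [j] gives a parallel edge, a step
    along [j] the same edge. *)
Lemma edge_pair j l x y : (edge l x * edge j y)%g \in G.
Proof.
apply: tperm_pair_trans (edge_cross j l x) _.
move: y; apply: (@flip_ind _ x) => [|k y xy]; first by rewrite tperm2.
apply: tperm_pair_trans xy _.
have [->|kj] := eqVneq k j; last exact: edge_parallel.
by rewrite /edge flipK [tperm (flip j y) _]tpermC tperm2.
Qed.

(** Induction along a path from [x]: conjugating [tperm x y] by the next edge moves its endpoint to
    [flip k y]. *)
Lemma tperm_edge l x y : x != y -> (tperm x y * edge l x)%g \in G.
Proof.
move: y; apply: (@flip_ind _ x) => [|k y IHy xky]; first by rewrite eqxx.
have [xy|xy] := eqVneq x y; first by rewrite -xy; exact: edge_cross.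
apply: tperm_pair_trans (IHy xy); apply: tperm_pair_step => //.
apply: tperm_pair_trans (edge_pair l k y x) _.
exact/tperm_pair_sym/IHy.
Qed.

Lemma Alt_sub_mcx : ('Alt_(bvec n) \subset G)%g.
Proof.
apply: tperm_pairs_Alt => x y z w xy zw.
have l : 'I_n by apply: Ordinal n_ge4.
apply: tperm_pair_trans (tperm_edge l xy) _.
by apply: tperm_pair_trans (edge_pair l l x z) _; exact/tperm_pair_sym/tperm_edge.
Qed.

End Cube.

(** * Even permutations as circuits *)

Lemma circuit_fun_cat N (S1 S2 : circuit N) x :
  circuit_fun (S1 ++ S2) x = circuit_fun S2 (circuit_fun S1 x).
Proof. exact: foldl_cat. Qed.

Definition circuit_perms n : {set {perm bvec n}} :=
  [set s : {perm bvec n} | `[< exists S : circuit n, circuit_fun S =1 s >]].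

Lemma circuit_permsP n (s : {perm bvec n}) :
  reflect (exists S : circuit n, circuit_fun S =1 s) (s \in circuit_perms n).
Proof. by rewrite inE; exact: asboolP. Qed.

Lemma circuit_perms_group n : group_set (circuit_perms n).
Proof.
apply/group_setP; split.
  by apply/circuit_permsP; exists [::] => x; rewrite perm1.
move=> s t /circuit_permsP[S Ss] /circuit_permsP[U Ut].
by apply/circuit_permsP; exists (S ++ U) => x; rewrite circuit_fun_cat Ss Ut permM.
Qed.

(** For the all-ones pattern this is a gate; any other pattern is reached by conjugating with NOT
    gates, one bit at a time. *)
Lemma mcx_circuit n (I : {set 'I_n}) l y : l \notin I -> (#|I| <= 2)%N ->
  mcx I l y \in circuit_perms n.
Proof.
pose ones : bvec n := [ffun=> true].
have base (J : {set 'I_n}) m : m \notin J -> (#|J| <= 2)%N ->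
    mcx J m ones \in circuit_perms n.
  move=> mJ leJ; apply/circuit_permsP.
  have gP : ((J, m).2 \notin (J, m).1) && (#|(J, m).1| <= 2)%N by rewrite mJ.
  exists [:: exist _ (J, m) gP] => x; rewrite mcxE //=.
  have -> : on_face J ones x = [forall (i | i \in J), x i].
    by apply: eq_forallb => i; rewrite ffunE eqb_id.
  apply/ffunP=> i; rewrite ffunE /gate_target /gate_controls /=.
  case: ifP => [/eqP ->|im]; case: ifP => // h.
  - by rewrite flipE eqxx.
  - by rewrite addbF.
  - by rewrite flipE im addbF.
move=> lI leI; move: y.
apply: (@flip_ind _ _ ones) => [|k y yG]; first exact: base.
rewrite -mcx_flip //.
have -> : mcx finset.set0 k y = mcx finset.set0 k ones.
  by apply/permP=> x; rewrite !mcxE ?in_set0 // !on_face0.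
by rewrite !(groupM (G := Group (circuit_perms_group n))) // base ?in_set0 ?cards0.
Qed.

Lemma Alt_circuit n (s : {perm bvec n}) : (4 <= n)%N -> (s \in 'Alt_(bvec n))%g ->
  exists S : circuit n, circuit_fun S =1 s.
Proof.
move=> n4 sA; apply/circuit_permsP.
apply: (subsetP (Alt_sub_mcx (G := Group (circuit_perms_group n)) _ n4) _ sA).
exact: mcx_circuit.
Qed.

(** * Additional inputs, and the lower count of implementable transformations *)

Lemma pad0_lshift n q (x : bvec n) i : pad0 q x (lshift q i) = x i.
Proof.
rewrite ffunE; case: split_ordP => j; first by move/lshift_inj ->.
by move/eqP; rewrite eq_lrshift.
Qed.

Lemma lift_gate_subproof n q (g : gate n) :
  let c := ([set lshift q i | i in gate_controls g], lshift q (gate_target g)) in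
  (c.2 \notin c.1) && (#|c.1| <= 2)%N.
Proof.
have inj : injective (@lshift n q) by exact: lshift_inj.
by rewrite /= (mem_imset _ _ inj) card_imset //; exact: valP g.
Qed.

Definition lift_gate n q (g : gate n) : gate (n + q) :=
  exist _ ([set lshift q i | i in gate_controls g], lshift q (gate_target g))
    (lift_gate_subproof q g).

Lemma lift_gateE n q (g : gate n) x :
  gate_fun (lift_gate q g) (pad0 q x) = pad0 q (gate_fun g x).
Proof.
apply/ffunP=> k; rewrite /gate_fun ffunE.
have -> : [forall (i | i \in gate_controls (lift_gate q g)), pad0 q x i]
        = [forall (i | i \in gate_controls g), x i].
  apply/forall_inP/forall_inP => [h i ig|h _ /imsetP[i ig ->]].
    by rewrite -(pad0_lshift q); apply: h; apply: imset_f.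
  by rewrite pad0_lshift h.
rewrite -(splitK k) /gate_target /=; case: (fintype.split k) => i /=.
  by rewrite !pad0_lshift ffunE (inj_eq (@lshift_inj _ _)).
rewrite eq_rlshift !ffunE.
by case: split_ordP => // j /eqP; rewrite eq_rlshift.
Qed.

Lemma lift_circuitE n q (S : circuit n) x :
  circuit_fun (map (lift_gate q) S) (pad0 q x) = pad0 q (circuit_fun S x).
Proof. by elim: S x => //= g S IHS x; rewrite lift_gateE IHS. Qed.

Lemma card_implementable_ge n q : (4 <= n)%N ->
  ((2 ^ n)`! <= 2 * #|implementable_set n q|)%N.
Proof.
move=> n4; have cT : #|{: bvec n}| = (2 ^ n)%N.
  by rewrite card_ffun card_bool card_ord.
rewrite -cT -card_Alt; last by rewrite cT -{1}(expn0 2) ltn_exp2l // (leq_trans _ n4).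
rewrite leq_mul2l /=.
pose ff (s : {perm bvec n}) : {ffun bvec n -> bvec n} := [ffun x => s x].
have ff_inj : injective ff.
  by move=> s t /ffunP st; apply/permP=> x; have := st x; rewrite !ffunE.
rewrite -(card_imset _ ff_inj); apply: subset_leq_card.
apply/subsetP=> _ /imsetP[s sA ->]; rewrite inE; apply/asboolP.
have [S Ss] := Alt_circuit n4 sA.
exists (map (lift_gate q) S), 1%g => x i.
by rewrite perm1 lift_circuitE pad0_lshift Ss ffunE.
Qed.

(** * Coding of circuits, and the upper count *)

(* A gate with at most two controls is coded by its target and two wires; a
   code (j, j, b) with b != j is free to stand for "no gate". *)
Definition decode_gate N (c : 'I_N * 'I_N * 'I_N) : option (gate N) :=
  let: (j, a, b) := c in
  if (a == j) && (b != j) then None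
  else (insub : _ -> option (gate N)) ([set a; b] :\ j, j).

Lemma decode_gate_surj N (o : option (gate N)) : (1 < N)%N ->
  exists c, decode_gate c = o.
Proof.
move=> N1; case: o => [g|]; last first.
  (* Wires 0, 0, 1 code the absence of a gate; the second wire exists because [1 < N]. *)
  exists (Ordinal (ltnW N1), Ordinal (ltnW N1), Ordinal N1).
  by [].
case: g => [[I j]] gP; have /= /andP[jI le2] := gP.
suff [a [b [nab eI]]] : exists a b, ~~ ((a == j) && (b != j)) /\ [set a; b] :\ j = I.
  by exists (j, a, b); rewrite /= (negbTE nab) eI insubT.
have setD j' (A : {set 'I_N}) : j' \notin A -> A :\ j' = A.
  by move=> h; apply/setDidPl; rewrite disjoint_sym disjoints1.
move: le2; rewrite leq_eqVlt => /orP[/cards2P[a [b [ab eI]]]|].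
  exists a, b; subst I; rewrite setD //; split=> //.
  by apply/nandP; left; apply: contraNneq jI => ->; rewrite !inE eqxx.
rewrite ltnS leq_eqVlt => /orP[/cards1P[a eI]|].
  exists a, a; subst I; rewrite setUid setD //; split=> //.
  by rewrite andbN.
rewrite ltnS leqn0 cards_eq0 => /eqP ->; exists j, j.
by rewrite eqxx setUid setDv.
Qed.

(** Codes of [None] pad short sequences, so tuples of one fixed length cover all circuits up to that
    length. *)
Lemma pmap_surj (T U : Type) (f : T -> option U) k (s : seq U) :
  (forall o, exists c, f c = o) -> (size s <= k)%N ->
  exists t : k.-tuple T, pmap f t = s.
Proof.
move=> f_surj; elim: k s => [|k IHk] [|u s] //= => [_|_|].
- by exists [tuple].
- have [t ts] := IHk [::] isT; have [c cN] := f_surj None.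
  by exists [tuple of c :: t]; rewrite /= cN.
- rewrite ltnS => /IHk[t ts]; have [c cu] := f_surj (Some u).
  by exists [tuple of c :: t]; rewrite /= cu /= ts.
Qed.

Lemma implementable_short n q (f : {ffun bvec n -> bvec n}) :
  f \in implementable_set n q ->
  exists2 S : circuit (n + q), implements S f & (size S <= max_complexity n q)%N.
Proof.
move=> fF; have : (min_complexity q f <= max_complexity n q)%N.
  exact: (@leq_bigmax_cond _ _ (min_complexity q)).
rewrite /min_complexity.
move: (fF); rewrite inE => /asboolP[S0 S0f].
(* Implementability of [f] rules out the dummy value. *)
case: pselect => [e|[]]; last first.
  by exists (size S0); apply/asboolP; exists S0.
case: ex_minnP => m /asboolP[S [Sf <-]] _ le_m.
by exists S.
Qed.

Lemma card_implementable_le n q : (1 < n + q)%N ->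
  (#|implementable_set n q| <= (n + q) ^ (3 * max_complexity n q + n))%N.
Proof.
move=> N1; set N := (n + q)%N; set m := max_complexity n q.
(* Only the first [n] values of the output permutation matter; coding them by an arbitrary map costs
   the factor [N ^ n]. *)
pose code := (m.-tuple ('I_N * 'I_N * 'I_N) * {ffun 'I_n -> 'I_N})%type.
pose dec (c : code) : {ffun bvec n -> bvec n} :=
  [ffun x => [ffun i =>
     circuit_fun (pmap (@decode_gate N) c.1) (pad0 q x) (c.2 i)]].
have <- : #|{: code}| = (N ^ (3 * m + n))%N.
  rewrite card_prod card_tuple !card_prod card_ffun !card_ord.
  by rewrite expnD expnM (expnS _ 2) (expnS _ 1) expn1 mulnA.
apply: leq_trans (leq_imset_card dec _); apply: subset_leq_card.
apply/subsetP=> f /implementable_short[S [p fS] leS].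
have [t tS] := pmap_surj (fun o => decode_gate_surj o N1) leS.
apply/imsetP; exists (t, [ffun i => p (lshift q i)]) => //.
by apply/ffunP=> x; apply/ffunP=> i; rewrite !ffunE fS tS.
Qed.

(** * A lower bound for the factorial *)

(** Bernoulli's inequality for [(1 - 1/(b+1)) ^ k], cleared of denominators; truncated subtraction
    makes it trivial for large [k]. *)
Lemma expS_mul_sub b k : (b.+1 ^ k * (b.+1 - k) <= b ^ k * b.+1)%N.
Proof.
elim: k => [|k IHk]; first by rewrite !expn0 subn0.
apply: (@leq_trans (b * (b.+1 ^ k * (b.+1 - k)))%N); last first.
  by rewrite expnS -mulnA leq_mul2l IHk orbT.
rewrite expnS -mulnA mulnCA (mulnCA b) leq_mul2l; apply/orP; right.
rewrite subSS; have [kb|/ltnW/eqP ->] := leqP k b; last by rewrite muln0.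
by rewrite subSn // mulSn mulnS leq_add2r leq_subr.
Qed.

Lemma expS_le_double b k : (k.*2 <= b.+1)%N -> (b.+1 ^ k <= 2 * b ^ k)%N.
Proof.
move=> kb; rewrite -(leq_pmul2r (ltn0Sn b)) -mulnA.
apply: leq_trans (leq_mul (leqnn 2) (expS_mul_sub b k)).
rewrite mulnCA leq_mul2l; apply/orP; right.
by rewrite mul2n doubleB -addnn -addnBA // leq_addr.
Qed.

(** A cheap form of [(1 + 1/m) ^ m < e]: the doubling bound is squared at half the exponent. For odd
    [m] the exponent is raised to [m + 1] and one factor cancelled. *)
Lemma expS_le_quadruple m : (m.+1 ^ m <= 4 * m ^ m)%N.
Proof.
have sq k : (k.*2 <= m.+1)%N -> (m.+1 ^ k.*2 <= 4 * m ^ k.*2)%N.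
  move=> /expS_le_double h; rewrite -muln2 !expnM.
  by rewrite (leq_trans (leq_mul h h)) // mulnACA.
have [om|om] := boolP (odd m); last by have := sq m./2; rewrite even_halfK // => ->.
have := sq m.+1./2; rewrite even_halfK /= ?om // => /(_ (leqnn _)).
rewrite !expnS => h; rewrite -(leq_pmul2l (ltn0Sn m)); apply: leq_trans h _.
by rewrite mulnCA leq_mul2r leqnSn orbT.
Qed.

(** Each induction step costs at most a factor 4. The slack 2, present at [m = 1], later absorbs the
    index of the alternating group. *)
Lemma expn_diag_le_fact m : (0 < m)%N -> (2 * m ^ m <= 4 ^ m * m`!)%N.
Proof.
elim: m => // -[_ _|m IHm _] //.
have {}IHm := IHm isT.
rewrite factS (expnS _ m.+1) (expnS 4%N) mulnCA [leqRHS]mulnCA leq_mul2l /= -mulnA.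
apply: leq_trans (leq_mul (leqnn 4) IHm).
by rewrite mulnCA leq_mul2l /= expS_le_quadruple.
Qed.

Lemma exp2_le_fact n : (2 <= n)%N -> (2 * 2 ^ (2 ^ n * (n - 2)) <= (2 ^ n)`!)%N.
Proof.
move=> n2; have M0 : (0 < 2 ^ n)%N by rewrite expn_gt0.
rewrite -(leq_pmul2l (_ : 0 < 4 ^ (2 ^ n))%N) ?expn_gt0 //.
apply: leq_trans (expn_diag_le_fact M0).
rewrite mulnCA leq_mul2l /= -[4%N]/(2 ^ 2)%N -!expnM -expnD leq_exp2l //.
by rewrite (mulnC 2%N) -mulnDr subnKC // mulnC.
Qed.

(** * Comparison of the two counts *)

Theorem theorem1 (R : realType) :
  exists n0 : nat, forall n q : nat, (n0 < n)%N ->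
    (max_complexity n q)%:R >=
      (2 ^+ n * (n%:R - 2)) / (3 * log2 (n + q)%:R) - n%:R / 3 :> R.
Proof.
(* Generating the alternating group was proved for [4 <= n]. *)
exists 3%N => n q n4; set s := max_complexity n q.
have n2 : (2 <= n)%N by apply: leq_trans n4.
have N1 : (1 < n + q)%N by apply: leq_trans n2 (leq_addr _ _).
have le_nat : (2 ^ (2 ^ n * (n - 2)) <= (n + q) ^ (3 * s + n))%N.
  rewrite -(leq_pmul2l (ltn0Sn 1)); apply: leq_trans (exp2_le_fact n2) _.
  apply: leq_trans (card_implementable_ge q n4) _.
  by rewrite leq_mul2l /= card_implementable_le.
have ln2_gt0 : 0 < ln 2 :> R by rewrite ln_gt0 // ltr1n.
have N0 : 0 < (n + q)%:R :> R by rewrite ltr0n ltnW.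
have lnN_gt0 : 0 < ln (n + q)%:R :> R by rewrite ln_gt0 // ltr1n.
have log_gt0 : 0 < log2 (n + q)%:R :> R by rewrite divr_gt0.
have le_log : 2 ^+ n * (n%:R - 2) <= (3 * s%:R + n%:R) * log2 (n + q)%:R :> R.
  rewrite /log2 mulrA ler_pdivlMr //.
  have : ln (2 ^ (2 ^ n * (n - 2)))%:R <= ln ((n + q) ^ (3 * s + n))%:R :> R.
    by rewrite ler_ln ?posrE ?ltr0n ?expn_gt0 ?ler_nat // ltnW.
  have lnX (a k : nat) : (0 < a)%N -> ln (a ^ k)%:R = k%:R * ln a%:R :> R.
    by move=> a0; rewrite natrX lnXn ?ltr0n // mulr_natl.
  rewrite (lnX 2%N _ isT) (lnX _ _ (ltnW N1)).
  rewrite (natrM _ (2 ^ n)) natrX (natrB _ n2) (natrD _ (3 * s)) (natrM _ 3).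
  exact.
rewrite lerBlDr ler_pdivrMr; last by apply: (mulr_gt0 _ log_gt0).
apply: le_trans le_log _.
by rewrite [leRHS]mulrA [(_ + _ / _) * 3]mulrDl divfK ?pnatr_eq0 // (mulrC s%:R).
Qed.
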